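(* Let $3 \leqslant m \leqslant n$ and $k\geqslant 0$ be integers. If the complete bipartite graph $K_{m,n}$ has a $B_{k}^{m}$-EPG representation (an EPG representation in which every path is monotonic and has at most $k$ bends), then $$n\left(m - \left\lceil \frac{k+1}{2}\right\rceil\right) \leqslant \binom{m}{2}\left( 2\left\lfloor \frac{k+1}{2}\right\rfloor \left\lceil \frac{k+1}{2}\right\rceil + k \right) + \frac{1}{4}m^2\left(1 + \left\lceil \frac{k+1}{2}\right\rceil - \left\lfloor \frac{k+1}{2}\right\rfloor \right).$$
   Context: $K_{m,n}$ is the complete bipartite graph with partition classes of sizes $m$ and $n$. A grid consists of horizontal grid lines (rows, increasing from bottom to top) and vertical grid lines (columns, increasing from left to right). A grid point is a crossing of two grid lines. A grid edge is the part of a grid line between two consecutive grid points. A path on a grid consists of two grid points (its end points) and a number of consecutive grid edges connecting them. A bend of a path is a turn of the path at a grid point. An EPG representation of a graph $G$ assigns to each vertex $v$ of $G$ a path $P_v$ on a common grid such that two distinct vertices $v,w$ are adjacent in $G$ if and only if $P_v$ and $P_w$ share at least one grid edge. A path is monotonic if it is ascending in both columns and rows, i.e. it has the shape of a staircase going upwards from left to right. In the term ''$B_k^m$-EPG representation'' the superscript $m$ is just a symbol for ''monotonic'' and is unrelated to the integer $m$. *)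

(* Defs.v *)
From mathcomp Require Import all_boot all_order all_algebra.

Set Implicit Arguments.
Unset Strict Implicit.
Unset Printing Implicit Defensive.

Import GRing.Theory Num.Theory.
Local Open Scope ring_scope.

(* Grid points are (column, row).  Every finite grid embeds, with consecutive
   lines going to consecutive lines, in Z x Z, which serves as common grid. *)
Definition gpoint : Type := (int * int)%type.

(* [p] and [q] are the two ends of a vertical, resp. horizontal, grid edge. *)
Definition vert_edge (p q : gpoint) : bool :=
  (p.1 == q.1) && (`|p.2 - q.2| == 1).
Definition horiz_edge (p q : gpoint) : bool :=
  (p.2 == q.2) && (`|p.1 - q.1| == 1).
Definition grid_adj : rel gpoint :=
  [rel p q | vert_edge p q || horiz_edge p q].

(* A path is given by the list of grid points it visits, read from either one
   of its two end points. *)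
Definition grid_path (s : seq gpoint) : bool :=
  [&& (1 < size s)%N, sorted grid_adj s & uniq s].

(* Grid edges are unordered: [uses_edge] ignores the direction of traversal. *)
Definition steps (s : seq gpoint) : seq (gpoint * gpoint) := zip s (behead s).
Definition uses_edge (s : seq gpoint) (p q : gpoint) : bool :=
  ((p, q) \in steps s) || ((q, p) \in steps s).
Definition share_edge (s t : seq gpoint) : Prop :=
  exists p q : gpoint, uses_edge s p q /\ uses_edge t p q.

Definition turn (p q r : gpoint) : bool :=
  (vert_edge p q && horiz_edge q r) || (horiz_edge p q && vert_edge q r).
Fixpoint bends (s : seq gpoint) : nat :=
  if s is p :: s' then
    ((if s' is q :: r :: _ then turn p q r : nat else 0) + bends s')%N
  else 0%N.

Definition ascending_step : rel gpoint :=
  [rel p q | (p.1 <= q.1) && (p.2 <= q.2)].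
(* The path is ascending when read from one of its two end points. *)
Definition monotonic (s : seq gpoint) : bool :=
  sorted ascending_step s || sorted ascending_step (rev s).

Definition EPG_representation (V : finType) (adj : rel V)
    (P : V -> seq gpoint) : Prop :=
  (forall v, grid_path (P v)) /\
  (forall v w, v != w -> (adj v w <-> share_edge (P v) (P w))).

Definition Bm_EPG_representation (k : nat) (V : finType) (adj : rel V)
    (P : V -> seq gpoint) : Prop :=
  EPG_representation adj P /\
  (forall v, monotonic (P v) /\ (bends (P v) <= k)%N).

Definition complete_bipartite (m n : nat) : rel ('I_m + 'I_n)%type :=
  fun v w => match v, w with
             | inl _, inr _ | inr _, inl _ => true
             | _, _ => false
             end.

(* Main.v *)
Require Import Defs.
From mathcomp Require Import all_boot all_order all_algebra.
From mathcomp Require Import zify lra.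
Import GRing.Theory Num.Theory.
Local Open Scope ring_scope.

(* Call A-paths and B-paths the paths of the two classes of sizes m and n, and
   let c, f be the two roundings of (k+1)/2.  Cut each B-path into at most c
   groups of two consecutive segments and assign each A-path to the group in
   which it touches the B-path: at least m - c pairs of A-paths fall into a
   common group.  Conversely fix two A-paths a, a'.  A B-path having both in one
   group either touches them on a common grid line, or bends at the crossing of
   a line of a with a line of a'.  A pair of lines determines the B-path, except
   that two B-paths may bend at the same crossing when both a and a' pass
   straight through it.  There are at most 2fc + (c - f) crossing pairs of lines
   (2fc if a and a' start in the same direction), and since the paths are
   monotonic each segment of a is involved in at most one common line or one
   straight crossing, which gives k + 1 further B-paths (k if a and a' start in
   the same direction and k > 0).  Summing over all pairs of A-paths, of which at
   most m^2/4 start in different directions, gives the bound. *)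

(** * Grid edges and ascending sequences of edges *)

(* The edge [((d, y), x)] is horizontal iff [d]; it lies on grid line number [y]
   and goes from position [x] to position [x + 1] on that line. *)
Definition line : Type := (bool * int)%type.
Definition edge : Type := (line * int)%type.

Definition source (e : edge) : gpoint :=
  if e.1.1 then (e.2, e.1.2) else (e.1.2, e.2).
Definition target (e : edge) : gpoint :=
  if e.1.1 then (e.2 + 1, e.1.2) else (e.1.2, e.2 + 1).
Definition link (e e' : edge) : bool := target e == source e'.

Fixpoint nturns (w : seq edge) : nat :=
  if w is e :: w' then
    ((if w' is e' :: _ then e.1.1 != e'.1.1 : nat else 0) + nturns w')%N
  else 0%N.

(** Encodes that [target e] is at most [source e'] in both coordinates, for each combination of
    directions. *)
Definition before (e e' : edge) : bool :=
  if e.1.1 == e'.1.1 then (e.2 + 1 <= e'.2) && (e.1.2 <= e'.1.2)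
  else (e.2 + 1 <= e'.1.2) && (e.1.2 <= e'.2).

Lemma before_trans : transitive before.
Proof.
move=> [[[] y] x] [[[] y'] x'] [[[] y''] x'']; rewrite /before /=; lia.
Qed.

Lemma link_before : subrel link before.
Proof.
by move=> [[[] y] x] [[[] y'] x'] /eqP[] /=; rewrite /before /=; lia.
Qed.

Lemma path_link_before e w e' : path link e w -> e' \in w -> before e e'.
Proof.
move=> /(sub_path link_before).
by move/(order_path_min before_trans)/allP => h /h.
Qed.

Lemma sorted_link_before w e e' : sorted link w -> e \in w -> e' \in w ->
  [\/ e = e', before e e' | before e' e].
Proof.
elim: w => [//|e0 w IH] /= hp; rewrite !inE.
case/predU1P=> [->|he]; case/predU1P=> [->|he'].
- by constructor 1.
- by constructor 2; apply: path_link_before he'.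
- by constructor 3; apply: path_link_before he.
- exact: IH (path_sorted hp) he he'.
Qed.

Lemma link_cases e e' : link e e' ->
  e' = (e.1, e.2 + 1) \/ e' = ((~~ e.1.1, e.2 + 1), e.1.2).
Proof.
by move: e e' => [[[] y] x] [[[] y'] x'] /eqP[] /= -> ->; [left|right|right|left].
Qed.

Lemma line_convex w l z1 z2 z : sorted link w -> (l, z1) \in w ->
  (l, z2) \in w -> z1 <= z <= z2 -> (l, z) \in w.
Proof.
elim: w z1 => [//|e w IH] z1 /= hp h1 h2 hz; rewrite inE in h1.
have [ze|ze] := eqVneq z z1; first by rewrite ze inE.
case/predU1P: h1 => [h1|h1]; last first.
  move: h2; rewrite inE => /predU1P[h2|h2].
    have := path_link_before _ _ _ hp h1; rewrite -h2 /before /= eqxx; lia.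
  by rewrite inE (IH z1) ?orbT // (path_sorted hp).
move: h2; rewrite inE -h1 xpair_eqE eqxx /= => /orP[/eqP h2|h2]; first lia.
case: w IH hp h2 => [//|e1 w] IH /= /andP[he hp] h2.
case: (link_cases _ _ he) => e1E.
  rewrite inE (IH (z1 + 1)) ?orbT //; first by rewrite e1E -h1 inE eqxx.
  by move: hz ze; lia.
move: h2; rewrite inE => /predU1P[h2|/(path_link_before _ _ _ hp)].
  by move: h2; rewrite e1E -h1 => -[/(congr1 fst) /=]; case: (l.1).
rewrite e1E -h1; rewrite /before /=; case: (l.1) => /=; lia.
Qed.

(** * Bends and the grouping of segments *)

(* [(e.1, e'.1.2 - 1)] is the edge on the line of [e] that ends at the crossing
   of the lines of [e] and [e']. *)
Definition turn_at (w : seq edge) (e e' : edge) : Prop :=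
  [/\ e.1.1 != e'.1.1, e.2 < e'.1.2, e.1.2 <= e'.2,
      (e.1, e'.1.2 - 1) \in w & (0 < nturns w)%N].

Lemma turn_at_sub u w e e' : {subset u <= w} -> (nturns u <= nturns w)%N ->
  turn_at u e e' -> turn_at w e e'.
Proof. by move=> hs hn [h1 h2 h3 /hs h4 /leq_trans/(_ hn) h5]. Qed.

Lemma turn_at_cons e0 w e e' : turn_at w e e' -> turn_at (e0 :: w) e e'.
Proof.
apply: turn_at_sub; last exact: leq_addl.
by move=> z hz; rewrite inE hz orbT.
Qed.

Lemma turn_at_line w l z z' e' : z' <= z ->
  turn_at w (l, z) e' -> turn_at w (l, z') e'.
Proof.
by move=> h [? h1 ? ? ?]; split=> //=; apply: Order.POrderTheory.le_lt_trans h1.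
Qed.

Lemma straight_last e w : path link e w -> nturns (e :: w) = 0%N ->
  (last e w).1 = e.1 /\ e.2 <= (last e w).2.
Proof.
elim: w e => [//|e1 w IH] e /= /andP[/link_cases[]-> hp] /=.
  by rewrite eqxx => h; case: (IH _ hp h) => -> /=; split=> //; lia.
by case: e.1.1.
Qed.

(** A stretch with at most one bend is straight or L-shaped; in the second case it bends at the
    crossing of the lines of its two extreme edges. *)
Lemma near_last e w : path link e w -> (nturns (e :: w) <= 1)%N ->
  (last e w).1 = e.1 \/ turn_at (e :: w) e (last e w).
Proof.
elim: w e => [|e1 w IH] e; first by left.
move=> /= /andP[/link_cases[]e1E hp].
  rewrite {1}e1E eqxx => h; case: (IH _ hp h) => [->|]; first by left; rewrite e1E.
  move=> h1; right; apply: turn_at_cons; move: h1; rewrite {2}e1E.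
  case: {+}e => l z /=; apply: turn_at_line; lia.
have -> : (e.1.1 != e1.1.1) = true by rewrite e1E /=; case: (e.1.1).
rewrite add1n ltnS leqn0 => /eqP h; right.
case: (straight_last _ _ hp h) => h1 h2; split.
- by rewrite h1 e1E /=; case: (e.1.1).
- by rewrite h1 e1E /=; lia.
- by move: h2; rewrite e1E.
- by rewrite h1 e1E /= addrK; case: {+}e => *; rewrite inE eqxx.
- by rewrite /= e1E /=; case: (e.1.1).
Qed.

Lemma first_turn e w e' : path link e w -> e' \in w -> e'.1.1 != e.1.1 ->
  exists2 e2 : edge, e2 \in w & turn_at (e :: w) e e2.
Proof.
elim: w e => [//|e1 w IH] e /= /andP[/link_cases[]e1E hp].
  rewrite inE => /predU1P[->|h1 h2]; first by rewrite e1E eqxx.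
  have hd : e'.1.1 != e1.1.1 by rewrite e1E.
  case: (IH _ hp h1 hd) => e2 h3 h4; exists e2; first by rewrite inE h3 orbT.
  apply: turn_at_cons; move: h4; rewrite {2}e1E; case: {+}e => l z /=.
  apply: turn_at_line; lia.
move=> _ _; exists e1; first by rewrite inE eqxx.
split; rewrite e1E //=.
- by case: e.1.1.
- lia.
- by rewrite addrK; case: {+}e => *; rewrite inE eqxx.
- by case: e.1.1.
Qed.

Lemma nturns_cat s e t :
  nturns (s ++ e :: t) = (nturns (rcons s e) + nturns (e :: t))%N.
Proof.
by elim: s => [|e0 [|e1 s] IH] //=; rewrite ?addn0 // -addnA -IH.
Qed.

Lemma nturns_rev w : nturns (rev w) = nturns w.
Proof.
elim: w => [//|e [|e1 w] IH]; first by [].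
rewrite rev_cons rev_cons -cats1 cat_rcons nturns_cat -rev_cons IH /=.
by rewrite !addn0 eq_sym addnC.
Qed.

Definition near (w : seq edge) (e e' : edge) : Prop :=
  [\/ e.1 = e'.1, turn_at w e e' | turn_at w e' e].

(* Halving the number of bends before [e] merges segments two by two. *)
Definition group (w : seq edge) (e : edge) : nat :=
  (nturns (take (index e w).+1 w))./2.

Lemma nturns_take w i : (nturns (take i w) <= nturns w)%N.
Proof.
have [hi|/take_oversize-> //] := ltnP i (size w).
case: i hi => [|i] /ltnW hi; first by rewrite take0.
rewrite -{2}(cat_take_drop i w) (drop_nth ((true, 0), 0) hi) nturns_cat.
by rewrite (take_nth ((true, 0), 0) hi) leq_addr.
Qed.

(** [uphalf k.+1] computes to [k./2.+1], one more than the largest possible group number. *)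
Lemma group_lt w e k : (nturns w <= k)%N -> (group w e < uphalf k.+1)%N.
Proof.
move=> h; rewrite /group ltnS half_leq //; apply: leq_trans h; exact: nturns_take.
Qed.

(** Numbers of bends with the same half differ by at most one, so the stretch between the two edges
    has at most one bend. *)
Lemma group_near w e e' : sorted link w -> e \in w -> e' \in w ->
  group w e = group w e' -> near w e e'.
Proof.
wlog le : e e' / (index e w <= index e' w)%N.
  move=> H hs h h' hg; case/orP: (leq_total (index e w) (index e' w)) => hi.
    exact: H.
  case: (H _ _ hi hs h' h (esym hg)) => h1;
    by [constructor 1|constructor 3|constructor 2].
move=> hs h h' hg.
set i := index e w in le *; set j := index e' w in le *.
have hi : (i < size w)%N by rewrite index_mem.
have hj : (j < size w)%N by rewrite index_mem.
pose u := drop i.+1 (take j.+1 w).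
have E : take j.+1 w = take i w ++ e :: u.
  rewrite -{1}(cat_take_drop i (take j.+1 w)) take_takel; last exact: leqW.
  congr (_ ++ _); rewrite (drop_nth e); last by rewrite size_takel.
  by rewrite nth_take // nth_index.
have El : last e u = e'.
  have : last e (take j.+1 w) = e' by rewrite (take_nth e hj) last_rcons nth_index.
  by rewrite E last_cat.
have hp : path link e u.
  have := take_sorted j.+1 hs; rewrite E.
  by case: (take i w) => [//|? s] /=; rewrite cat_path /= => /and3P[].
have Ei : take i.+1 w = rcons (take i w) e by rewrite (take_nth e hi) nth_index.
have hn : (nturns (e :: u) <= 1)%N.
  move: hg; rewrite /group -/i -/j E Ei nturns_cat.
  set t1 := nturns _; set t2 := nturns _ => hg.
  have := odd_double_half t1; have := odd_double_half (t1 + t2); rewrite hg.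
  by case: odd; case: odd; rewrite /=; lia.
case: (near_last _ _ hp hn); rewrite El => h1; first by constructor 1.
constructor 2; apply: turn_at_sub h1.
  by move=> z hz; apply: (@mem_take j.+1); rewrite E mem_cat hz orbT.
by apply: leq_trans (nturns_take w j.+1); rewrite E nturns_cat leq_addl.
Qed.

(** * Counting the grid lines of a path *)

Definition lines (w : seq edge) : seq line := undup [seq e.1 | e <- w].
Definition lines_along (d : bool) (w : seq edge) : seq line :=
  [seq l <- lines w | l.1 == d].

Lemma mem_lines w l : reflect (exists z : int, (l, z) \in w) (l \in lines w).
Proof.
rewrite mem_undup; apply: (iffP mapP) => [[[l' z] h ->]|[z h]]; first by exists z.
by exists (l, z).
Qed.

Lemma size_lines_along d w :
  size (lines w) = (size (lines_along d w) + size (lines_along (~~ d) w))%N.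
Proof.
rewrite !size_filter -(count_predC (fun l : line => l.1 == d)); congr addn.
by apply: eq_count => l /=; case: (l.1) d => [] [].
Qed.

Lemma lines_along_cons d e w :
  (size (lines_along d (e :: w)) <= (e.1.1 == d) + size (lines_along d w))%N.
Proof.
rewrite /lines_along /lines /=; case: ifP => _; first exact: leq_addl.
by rewrite /=; case: ifP.
Qed.

(** Segments alternate in direction, beginning with that of [e], so this direction gets the larger
    half of the segments, which are one more than the bends. *)
Lemma lines_bound e w : path link e w ->
  (size (lines_along e.1.1 (e :: w)) <= uphalf (nturns (e :: w)).+1)%N /\
  (size (lines_along (~~ e.1.1) (e :: w)) <= (nturns (e :: w)).+1./2)%N.
Proof.
elim: w e => [|e1 w IH] e.
  by rewrite /lines_along /lines /= eqxx; case: (e.1.1).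
move=> /andP[/link_cases he /IH{IH}].
have -> : nturns [:: e, e1 & w] = ((e.1.1 != e1.1.1) + nturns (e1 :: w))%N by [].
case: he => e1E.
  have E d : lines_along d [:: e, e1 & w] = lines_along d (e1 :: w).
    by rewrite /lines_along /lines /= e1E inE eqxx.
  by have -> : e1.1.1 = e.1.1 by [rewrite e1E]; rewrite eqxx !E.
move: (lines_along_cons e.1.1 e (e1 :: w)) (lines_along_cons (~~ e.1.1) e (e1 :: w)).
have -> : e1.1.1 = ~~ e.1.1 by rewrite e1E.
rewrite negbK eqxx; set n := nturns _.
by case: (e.1.1) => /= h1 h2 [h3 h4]; split; rewrite ?uphalfE; lia.
Qed.

(** * Common lines and straight crossings of two paths *)

Definition through (w : seq edge) (l : line) (x : int) : bool :=
  has [pred e : edge | (e.1 == l) && (e.2 < x)] w &&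
  has [pred e : edge | (e.1 == l) && (x <= e.2)] w.

(** For an ascending [w], convexity turns the two edges into a straight passage through position [x]
    of [l]. *)
Lemma throughP w l x :
  reflect (exists z1 z2 : int, [/\ (l, z1) \in w, (l, z2) \in w, z1 < x & x <= z2])
          (through w l x).
Proof.
apply: (iffP andP) => [[/hasP[[l1 z1] h1] /= /andP[/eqP E1 h2]]|].
  move=> /hasP[[l2 z2] h3 /= /andP[/eqP E2 h4]].
  by exists z1, z2; rewrite -{1}E1 -{1}E2.
by move=> [z1 [z2 [h1 h2 h3 h4]]]; split; apply/hasP;
  [exists (l, z1)|exists (l, z2)]; rewrite //= eqxx.
Qed.

(** Up to exchanging rows and columns, an edge of a transverse [l'] would come after the first of
    the two edges of [l], hence start no lower than [l], and before the second, hence end no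
    higher. *)
Lemma through_transverse w l l' : sorted link w -> through w l l'.2 ->
  l' \in lines w -> l'.1 = l.1.
Proof.
move=> hw /throughP[z1 [z2 [h1 h2 h3 h4]]] /mem_lines[z h].
move: (sorted_link_before _ _ _ hw h h1) (sorted_link_before _ _ _ hw h h2).
move: l l' {h h1 h2} h3 h4 => [d y] [d' y'] /= h3 h4.
by rewrite /before /=; case: d d' => [] [] //= [//|h5|h5] [//|h6|h6] //; lia.
Qed.

Lemma through_uniq w l1 l2 x : sorted link w -> l1.1 = l2.1 ->
  through w l1 x -> through w l2 x -> l1 = l2.
Proof.
move=> hw; move: l1 l2 => [d y] [_ y'] /= <-.
move=> /throughP[z1 [z2 [h1 h2 h3 h4]]] /throughP[z3 [z4 [h5 h6 h7 h8]]].
move: (sorted_link_before _ _ _ hw h1 h6) (sorted_link_before _ _ _ hw h2 h5).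
by rewrite /before /= eqxx => -[[? ?]|h9|h9] [[? ?]|h10|h10]; congr (_, _); lia.
Qed.

(* [l] and [l'] coincide, or [w] and [w'] pass straight through their crossing. *)
Definition event (w w' : seq edge) (l l' : line) : bool :=
  (l == l') || [&& l.1 != l'.1, through w l l'.2 & through w' l' l.2].

Lemma eventC w w' l l' : event w w' l l' = event w' w l' l.
Proof. by rewrite /event eq_sym (eq_sym l.1) (andbC (through _ _ _)). Qed.

(** If [w'] uses [l], it does not pass straight through it; otherwise it passes straight through [l]
    at most once. *)
Lemma event_inj w w' l l1 l2 : sorted link w' ->
  l1 \in lines w' -> l2 \in lines w' ->
  event w w' l l1 -> event w w' l l2 -> l1 = l2.
Proof.
move=> hw h1 h2 /orP[/eqP E1|/and3P[n1 _ t1]] /orP[/eqP E2|/and3P[n2 _ t2]].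
- by rewrite -E1.
- by rewrite -{}E1 in h1 *; case/eqP: n2; apply: through_transverse t2 h1.
- by rewrite -{}E2 in h2 *; case/eqP: n1; apply: through_transverse t1 h2.
- by apply: through_uniq t1 t2 => //; move: n1 n2; case: l.1 l1.1 l2.1 => [] [] [].
Qed.

Definition events (w w' : seq edge) : seq (line * line) :=
  [seq p <- [seq (l, l') | l <- lines w, l' <- lines w'] | event w w' p.1 p.2].

Lemma mem_events w w' l l' : ((l, l') \in events w w') =
  [&& event w w' l l', l \in lines w & l' \in lines w'].
Proof.
rewrite mem_filter /=; congr andb.
apply/allpairsP/andP => [[[l1 l1'] /= [h1 h2 [-> ->]]]|[h1 h2]] //.
by exists (l, l').
Qed.

Lemma uniq_events w w' : uniq (events w w').
Proof. by rewrite filter_uniq // allpairs_uniq ?undup_uniq // => -[? ?] [? ?]. Qed.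

Lemma uniq_events1 w w' : sorted link w' -> uniq [seq p.1 | p <- events w w'].
Proof.
move=> hw; rewrite map_inj_in_uniq ?uniq_events // => -[l l1] [l' l2].
rewrite !mem_events /= => /and3P[h1 _ h2] /[swap] <- /and3P[h3 _ h4].
by rewrite (event_inj _ _ _ _ _ hw h2 h4 h1 h3).
Qed.

Lemma sub_events1 w w' : {subset [seq p.1 | p <- events w w'] <= lines w}.
Proof. by move=> l /mapP[[l1 l2]]; rewrite mem_events => /and3P[_ h _] ->. Qed.

Lemma size_events w w' : sorted link w' -> (size (events w w') <= size (lines w))%N.
Proof.
move=> hw; rewrite -(size_map fst); apply: uniq_leq_size; first exact: uniq_events1.
exact: sub_events1.
Qed.

Lemma size_eventsC w w' : size (events w w') = size (events w' w).
Proof.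
rewrite -[RHS](size_map (fun p => (p.2, p.1))); apply/perm_size/uniq_perm.
- exact: uniq_events.
- by rewrite map_inj_uniq ?uniq_events // => -[? ?] [? ?] [-> ->].
move=> [l l']; rewrite mem_events eventC [X in _ && X]andbC -mem_events.
apply/idP/mapP => [h|[[l1 l2] h [-> ->]]] //; by exists (l', l).
Qed.

(** The projection from events to lines of [w] is injective, so by cardinality it is onto. *)
Lemma events_cover w w' l : sorted link w' ->
  (size (lines w) <= size (events w w'))%N -> l \in lines w ->
  exists2 l' : line, l' \in lines w' & event w w' l l'.
Proof.
move=> hw hs hl.
have [_ E] : (size [seq p.1 | p <- events w w'] = size (lines w)) *
             ([seq p.1 | p <- events w w'] =i lines w).
  apply: uniq_min_size; rewrite ?size_map ?uniq_events1 //; exact: sub_events1.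
move: hl; rewrite -E => /mapP[[l1 l2] h ->].
by move: h; rewrite mem_events => /and3P[h1 _ h2]; exists l2.
Qed.

Lemma size_lines e w : path link e w -> (size (lines (e :: w)) <= (nturns (e :: w)).+1)%N.
Proof.
move=> hp; rewrite (size_lines_along e.1.1); have [] := lines_bound _ _ hp.
set t := nturns _; have := uphalf_half t.+1; have := odd_double_half t.+1; lia.
Qed.

(** * Paths that start in the same direction *)

(* The lowest row of [e :: u] can only be in an event with [e' :: u'] if the
   latter starts at most as high (with rows replaced by columns if [e] is
   vertical). *)
Lemma head_line e u e' u' : path link e' u' -> e.1.1 = e'.1.1 ->
  (exists2 l' : line, l' \in lines (e' :: u') & event (e :: u) (e' :: u') e.1 l') ->
  e'.1.2 <= e.1.2.
Proof.
move=> hp hd [l' hl' /orP[/eqP E|/and3P[hn _ /throughP[z [_ [h _ hz _]]]]]].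
  move/mem_lines: hl' => [z]; rewrite inE -E => /predU1P[<- //|].
  by move/(path_link_before _ _ _ hp); rewrite /before /= hd eqxx => /andP[].
move: h; rewrite inE => /predU1P[h|/(path_link_before _ _ _ hp)].
  by rewrite hd -h /= eqxx in hn.
by rewrite /before /= -hd (negbTE hn) => /andP[_]; lia.
Qed.

(* Both paths start on the same line, say with [e] before [e']; then the line of
   the first bend of [e :: u] is in no event, as [e' :: u'] lies beyond it. *)
Lemma not_all_events e u e' u' :
  path link e u -> path link e' u' ->
  (forall z : edge, z \in e :: u -> z \in e' :: u' -> False) -> e.1.1 = e'.1.1 ->
  has (fun z : edge => z.1.1 != e.1.1) u -> has (fun z : edge => z.1.1 != e'.1.1) u' ->
  (forall l : line, l \in lines (e :: u) ->
     exists2 l' : line, l' \in lines (e' :: u') & event (e :: u) (e' :: u') l l') ->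
  (forall l' : line, l' \in lines (e' :: u') ->
     exists2 l : line, l \in lines (e :: u) & event (e' :: u') (e :: u) l' l) ->
  False.
Proof.
have head_in z w : z.1 \in lines (z :: w).
  by rewrite mem_undup; apply: map_f; rewrite inE eqxx.
wlog le : e u e' u' / e.2 <= e'.2.
  move=> H hp hp' hd E t t' h h'.
  have [le|le] : e.2 <= e'.2 \/ e'.2 <= e.2 by lia.
    exact: (H e u e' u').
  by apply: (H e' u' e u) => // z z1 z2; apply: (hd z).
move=> hp hp' hd E t t' h h'.
have Ey : e.1.2 = e'.1.2.
  have h1 := head_line _ _ _ _ hp' E (h _ (head_in _ _)).
  have h2 := head_line _ _ _ _ hp (esym E) (h' _ (head_in _ _)).
  by apply: Order.POrderTheory.le_anti; rewrite h1 h2.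
have El : e.1 = e'.1 by move: E Ey; case: (e.1) (e'.1) => [? ?] [? ?] /= -> ->.
have lt : e.2 < e'.2.
  have : e != e' by apply/eqP => E1; apply: (hd e); rewrite ?E1 inE eqxx.
  move: le El; case: {+}e {+}e' => l x [l' x'] /= le ->; rewrite xpair_eqE eqxx /=. lia.
have [z hz hzd] := hasP t.
have [e2 he2 [n1 n2 n3 n4 _]] := first_turn _ _ _ hp hz hzd.
(* Otherwise [e'] lies between [e] and the first bend, and convexity makes it an edge of
   [e :: u]. *)
have x1 : e2.1.2 <= e'.2.
  have [//|x1] : e2.1.2 <= e'.2 \/ e'.2 < e2.1.2 by lia.
  case: (hd e'); last by rewrite inE eqxx.
  rewrite [e']surjective_pairing -El; apply: (line_convex _ _ e.2 (e2.1.2 - 1)) => //.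
  - by rewrite -surjective_pairing inE eqxx.
  - lia.
have [|l' hl'] := h e2.1; first by rewrite mem_undup; apply: map_f; rewrite inE he2 orbT.
(* Either kind of event needs an edge of [e' :: u'] on the line [e2.1] or before it, whereas [e']
   already starts there or beyond and moves away. *)
case/orP=> [/eqP E1|/and3P[ne _ /throughP[z1 [_ [h1 _ hz1 _]]]]].
  move/mem_lines: hl' => [z1]; rewrite -E1 inE => /predU1P[E2|].
    by move: n1; rewrite E -E2 eqxx.
  move/(path_link_before _ _ _ hp'); rewrite /before /= -E (negbTE n1); lia.
move: h1; rewrite inE => /predU1P[E2|]; first by move: x1; rewrite -E2 /=; lia.
move/(path_link_before _ _ _ hp'); rewrite /before /= -E.
have -> : (e.1.1 == l'.1) = true by move: ne n1; case: e.1.1 l'.1 e2.1.1 => [] [] [].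
lia.
Qed.

(** With [k + 1] events every line of both paths would be in one. For [k > 0] both paths would then
    bend, as one direction accounts for at most [uphalf k.+1 <= k] lines. *)
Lemma size_events_lt k e u e' u' : (0 < k)%N ->
  path link e u -> path link e' u' ->
  (forall z : edge, z \in e :: u -> z \in e' :: u' -> False) -> e.1.1 = e'.1.1 ->
  (nturns (e :: u) <= k)%N -> (nturns (e' :: u') <= k)%N ->
  (size (events (e :: u) (e' :: u')) <= k)%N.
Proof.
move=> k0 hp hp' hd E hk hk'; rewrite leqNgt; apply/negP => hs.
have turns e0 u0 : path link e0 u0 -> (nturns (e0 :: u0) <= k)%N ->
    (k < size (lines (e0 :: u0)))%N -> has (fun z : edge => z.1.1 != e0.1.1) u0.
  move=> hp0 hk0 hs0; have [h1 h2] := lines_bound _ _ hp0.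
  have: (0 < size (lines_along (~~ e0.1.1) (e0 :: u0)))%N.
    by move: hs0; rewrite (size_lines_along e0.1.1); lia.
  rewrite size_filter -has_count => /hasP[l /mem_lines[z]].
  rewrite inE => /predU1P[<- /= /eqP|h3 /= /eqP h4]; first by case: (l.1).
  by apply/hasP; exists (l, z) => //=; rewrite h4; case: (e0.1.1).
have s1 := leq_trans hs (size_events (e :: u) (e' :: u') hp').
have := hs; rewrite size_eventsC => hs'.
have s2 := leq_trans hs' (size_events (e' :: u') (e :: u) hp).
apply: (not_all_events e u e' u') => //.
- exact: turns hp hk s1.
- exact: turns hp' hk' s2.
- move=> l; apply: events_cover => //; apply: leq_trans hs.
  by apply: leq_trans (size_lines _ _ hp) _.
- move=> l; apply: events_cover => //; apply: leq_trans hs'.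
  by apply: leq_trans (size_lines _ _ hp') _.
Qed.

(** * Disjoint paths on a common line *)

Lemma disjoint_neq (u u' : seq edge) l a b :
  (forall z : edge, z \in u -> z \in u' -> False) ->
  (l, a) \in u -> (l, b) \in u' -> a < b \/ b < a.
Proof.
move=> hd ha hb; have : a != b by apply/eqP => E; apply: (hd (l, a)); rewrite // E.
clear; lia.
Qed.

(** Disjoint paths occupy disjoint intervals of the line, so one comparison fixes their order. *)
Lemma disjoint_lt (u u' : seq edge) l a b c d : sorted link u -> sorted link u' ->
  (forall z : edge, z \in u -> z \in u' -> False) ->
  (l, a) \in u -> (l, b) \in u -> (l, c) \in u' -> (l, d) \in u' ->
  a < c -> b < d.
Proof.
move=> hu hu' hd ha hb hc hd' ac.
have [//|db] : b < d \/ d <= b by clear; lia.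
exfalso; have [ad|da] : a <= d \/ d <= a by clear; lia.
  by apply: (hd (l, d)) => //; apply: line_convex hu ha hb _; rewrite ad db.
apply: (hd (l, a)) => //; apply: line_convex hu' hd' hc _; rewrite da.
exact: Order.POrderTheory.ltW.
Qed.

(* A cycle of length 4 is not an interval graph. *)
Lemma convex_cycle4 w w' v v' l x1 x2 y1 y2 :
  sorted link w -> sorted link w' -> sorted link v -> sorted link v' ->
  (forall z : edge, z \in w -> z \in w' -> False) ->
  (forall z : edge, z \in v -> z \in v' -> False) ->
  (l, x1) \in w -> (l, x1) \in v -> (l, y1) \in w' -> (l, y1) \in v ->
  (l, x2) \in w -> (l, x2) \in v' -> (l, y2) \in w' -> (l, y2) \in v' -> False.
Proof.
move=> hw hw' hv hv' dw dv a1 b1 a2 b2 a3 b3 a4 b4.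
have dw' z : z \in w' -> z \in w -> False by move=> h1 h2; exact: dw z h2 h1.
have dv' z : z \in v' -> z \in v -> False by move=> h1 h2; exact: dv z h2 h1.
(* In each case the order of [w] and [w'] and that of [v] and [v'] compare two of the positions in
   opposite ways. *)
case: (disjoint_neq _ _ _ _ _ dw a1 a2) => h1;
  case: (disjoint_neq _ _ _ _ _ dv b1 b3) => h2.
- move: (disjoint_lt _ _ _ _ _ _ _ hw hw' dw a1 a3 a2 a2 h1).
  move: (disjoint_lt _ _ _ _ _ _ _ hv hv' dv b1 b2 b3 b3 h2); clear; lia.
- move: (disjoint_lt _ _ _ _ _ _ _ hw hw' dw a1 a1 a2 a4 h1).
  move: (disjoint_lt _ _ _ _ _ _ _ hv' hv dv' b3 b4 b1 b1 h2); clear; lia.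
- move: (disjoint_lt _ _ _ _ _ _ _ hw' hw dw' a2 a4 a1 a1 h1).
  move: (disjoint_lt _ _ _ _ _ _ _ hv hv' dv b1 b1 b3 b4 h2); clear; lia.
- move: (disjoint_lt _ _ _ _ _ _ _ hw' hw dw' a2 a2 a1 a3 h1).
  move: (disjoint_lt _ _ _ _ _ _ _ hv' hv dv' b3 b3 b1 b2 h2); clear; lia.
Qed.

Lemma card_le_size (I : finType) (T : eqType) (S : {set I}) (f : I -> T) (s : seq T) :
  {in S &, injective f} -> {in S, forall b, f b \in s} -> (#|S| <= size s)%N.
Proof.
move=> fI fs; rewrite cardE -(size_map f); apply: uniq_leq_size.
  by rewrite map_inj_in_uniq ?enum_uniq // => b b'; rewrite !mem_enum; apply: fI.
by move=> x /mapP[b]; rewrite mem_enum => /fs h ->.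
Qed.

(** * Counting the paths with near contacts to two given paths *)

Definition crossings (w w' : seq edge) : nat :=
  (size (lines_along true w) * size (lines_along false w') +
   size (lines_along false w) * size (lines_along true w'))%N.

Section Contacts.
Variables (I : finType) (B : I -> seq edge) (w w' : seq edge) (c c' : I -> edge).
Variable S : {set I}.
Hypotheses (w_link : sorted link w) (w'_link : sorted link w').
Hypothesis B_link : forall b, sorted link (B b).
Hypothesis ww' : forall z : edge, z \in w -> z \in w' -> False.
Hypothesis B_disj : forall b b' (z : edge), z \in B b -> z \in B b' -> b = b'.
Hypotheses (cw : forall b, c b \in w) (cB : forall b, c b \in B b).
Hypotheses (cw' : forall b, c' b \in w') (cB' : forall b, c' b \in B b).
Hypothesis S_near : forall b, b \in S -> near (B b) (c b) (c' b).

(** For bent contacts of members of [S], [forward] says that [B b] touches [w] before the bend and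
    [w'] after it. *)
Let forward b := (c b).2 < (c' b).1.2.
Let bent b := (c b).1.1 != (c' b).1.1.
Let pair b := ((c b).1, (c' b).1).

Lemma bent_near b : b \in S -> bent b ->
  if forward b then turn_at (B b) (c b) (c' b) else turn_at (B b) (c' b) (c b).
Proof.
move=> /S_near[E|h|h]; rewrite /bent /forward; first by rewrite E eqxx.
  by case: (h) => _ -> _ _ _.
by case: (h) => _ _ h1 _ _; rewrite Order.TotalTheory.ltNge h1.
Qed.

Lemma straight_near b : b \in S -> ~~ bent b -> (c b).1 = (c' b).1.
Proof.
by move=> /S_near[//|[h _ _ _ _]|[h _ _ _ _]]; rewrite /bent ?h // eq_sym h.
Qed.

(** Bends of equal orientation on the same two lines share the grid edge leading into the
    crossing. *)
Lemma bent_pair_inj b b' : b \in S -> b' \in S -> bent b -> bent b' ->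
  forward b = forward b' -> pair b = pair b' -> b = b'.
Proof.
move=> /bent_near h /bent_near h' /h{}h /h'{}h' E [E1 E2]; move: h h'; rewrite -E.
case: ifP => _ [_ _ _ h1 _] [_ _ _ h2 _]; apply: B_disj h1 _.
  by rewrite E1 E2.
by rewrite E1 E2.
Qed.

(** Two such paths would form with [w] and [w'] a 4-cycle on a single line. *)
Lemma straight_pair_inj b b' : b \in S -> b' \in S -> ~~ bent b -> ~~ bent b' ->
  pair b = pair b' -> b = b'.
Proof.
move=> /straight_near h /straight_near h' /h{}h /h'{}h' [E1 _].
apply/eqP/negPn/negP => /eqP hne.
move: (cw b) (cB b) (cw' b) (cB' b) (cw b') (cB b') (cw' b') (cB' b').
rewrite (surjective_pairing (c b)) (surjective_pairing (c' b)).
rewrite (surjective_pairing (c b')) (surjective_pairing (c' b')) -h -h' -E1.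
apply: convex_cycle4 => // z h1 h2; exact: hne (B_disj _ _ _ h1 h2).
Qed.

(* Two bends of opposite orientation at the same grid point meet both lines on
   both sides of that point. *)
Lemma both_bends_event b b' : b \in S -> b' \in S -> bent b -> bent b' ->
  forward b -> ~~ forward b' -> pair b = pair b' ->
  event w w' (c b).1 (c' b).1.
Proof.
move=> hb hb' nb nb' fb fb' [E1 E2]; apply/orP; right; apply/and3P; split=> //.
  apply/throughP; exists (c b).2, (c b').2.
  rewrite -surjective_pairing E1 -surjective_pairing; split=> //.
  by rewrite E2 Order.TotalTheory.leNgt.
apply/throughP; exists (c' b').2, (c' b).2.
rewrite -surjective_pairing E2 -surjective_pairing; split=> //.
  by have := bent_near _ hb' nb'; rewrite (negbTE fb') E1 => -[].
by have := bent_near _ hb nb; rewrite fb => -[].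
Qed.

(* At a crossing used in both orientations, [S1] keeps the forward one and the
   other one goes to [S2]. *)
Let S1 := [set b in S | bent b && (forward b || ~~ event w w' (c b).1 (c' b).1)].
Let S2 := [set b in S | bent b ==> ~~ forward b && event w w' (c b).1 (c' b).1].

Lemma card_bent : (#|S1| <= crossings w w')%N.
Proof.
pose X := [seq (l, l') | l <- lines_along true w, l' <- lines_along false w'] ++
          [seq (l, l') | l <- lines_along false w, l' <- lines_along true w'].
have -> : crossings w w' = size X by rewrite size_cat !size_allpairs.
apply: (@card_le_size _ _ _ pair) => [b b'|b].
  rewrite !inE => /and3P[h1 h2 h3] /and3P[h4 h5 h6] E.
  have [Ef|] := eqVneq (forward b) (forward b'); first exact: bent_pair_inj E.
  case: (boolP (forward b)) h3 => f1; case: (boolP (forward b')) h6 => f2 //=.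
    by case: (E) => <- <-; rewrite (both_bends_event b b').
  by case: (E) => -> ->; rewrite (both_bends_event b' b).
rewrite inE => /and3P[_ h _]; rewrite mem_cat; apply/orP.
have hl : (c b).1 \in lines w.
  by apply/mem_lines; exists (c b).2; rewrite -surjective_pairing.
have hl' : (c' b).1 \in lines w'.
  by apply/mem_lines; exists (c' b).2; rewrite -surjective_pairing.
move: h; rewrite /bent; case E: (c b).1.1; case E': (c' b).1.1 => // _; [left|right];
  apply/allpairsP; exists (pair b); rewrite !mem_filter /= E E'; split=> //.
Qed.

(** Straight contacts lie on a common line, and bent members of [S2] are all backward, so [pair]
    maps [S2] injectively into the events. *)
Lemma card_straight : (#|S2| <= size (events w w'))%N.
Proof.
apply: (@card_le_size _ _ _ pair) => [b b'|b].
  rewrite !inE => /andP[h1 h2] /andP[h3 h4] E.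
  have Eb : bent b = bent b' by case: E; rewrite /bent => -> ->.
  case: (boolP (bent b)) h2 => hb; last first.
    by move=> _; apply: straight_pair_inj; rewrite -?Eb.
  move: h4; rewrite -Eb hb /= => /andP[f2 _] /andP[f1 _].
  by apply: bent_pair_inj => //; rewrite -?Eb ?(negbTE f1) ?(negbTE f2).
rewrite inE => /andP[h1 h2]; rewrite mem_events; apply/and3P; split.
- case: (boolP (bent b)) h2 => [_ /andP[]//|hb _].
  by rewrite /event (straight_near _ h1 hb) eqxx.
- by apply/mem_lines; exists (c b).2; rewrite -surjective_pairing.
- by apply/mem_lines; exists (c' b).2; rewrite -surjective_pairing.
Qed.

Lemma card_near : (#|S| <= crossings w w' + size (events w w'))%N.
Proof.
apply: leq_trans (leq_add card_bent card_straight).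
apply: leq_trans (leq_card_setU _ _); apply: subset_leq_card.
apply/subsetP => b hb; rewrite !inE hb /=.
by case: (bent b) (forward b) (event _ _ _ _) => [] [] [].
Qed.

(** [turn_at] demands a positive number of turns, so here no contact is bent and all of [S] lies in
    [S2]. *)
Lemma card_near_straight : (forall b, nturns (B b) = 0)%N ->
  (#|S| <= size (events w w'))%N.
Proof.
move=> hB; apply: leq_trans card_straight; apply: subset_leq_card.
apply/subsetP => b hb; rewrite !inE hb /=; apply/implyP => nb.
by have := bent_near _ hb nb; case: ifP => _ [_ _ _ _]; rewrite hB.
Qed.

End Contacts.

(** With [p], [q] the larger and smaller half of [k.+1], equal initial directions give
    [p * q + q * p]. Different ones give [p * p + q * q], which is [2 * q * p + (p - q)] as [p - q]
    is 0 or 1. *)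
Lemma crossings_bound k e u e' u' : path link e u -> path link e' u' ->
  (nturns (e :: u) <= k)%N -> (nturns (e' :: u') <= k)%N ->
  (crossings (e :: u) (e' :: u') <= 2 * k.+1./2 * uphalf k.+1 +
     (e.1.1 != e'.1.1) * (uphalf k.+1 - k.+1./2))%N.
Proof.
move=> hp hp' hk hk'.
have [h1 h2] := lines_bound _ _ hp; have [h3 h4] := lines_bound _ _ hp'.
have {}h1 := leq_trans h1 (uphalf_leq (hk : nturns (e :: u) < k.+1)%N).
have {}h2 := leq_trans h2 (half_leq (hk : nturns (e :: u) < k.+1)%N).
have {}h3 := leq_trans h3 (uphalf_leq (hk' : nturns (e' :: u') < k.+1)%N).
have {}h4 := leq_trans h4 (half_leq (hk' : nturns (e' :: u') < k.+1)%N).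
have := uphalf_half k.+1; move: h1 h2 h3 h4; rewrite /crossings.
move: (uphalf k.+1) (k.+1)./2 => p q.
case: e.1.1 e'.1.1 => [] [] /= h1 h2 h3 h4 E; move: {+}h1 {+}h2 {+}h3 {+}h4.
all: have m1 := leq_mul h1 h4; have m2 := leq_mul h2 h3.
all: have m3 := leq_mul h1 h3; have m4 := leq_mul h2 h4.
all: move=> _ _ _ _; case: odd E => E; subst p; lia.
Qed.

(** * Counting pairs of indices *)

Lemma card_same_fiber m c (f : 'I_m -> 'I_c) :
  (m - c <= \sum_(p : 'I_m * 'I_m | (p.1 < p.2)%N) (f p.1 == f p.2))%N.
Proof.
pose Q := [set p : 'I_m * 'I_m | (p.1 < p.2)%N && (f p.1 == f p.2)].
have -> : (\sum_(p : 'I_m * 'I_m | (p.1 < p.2)%N) (f p.1 == f p.2) = #|Q|)%N.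
  rewrite -sum1_card big_mkcond [RHS]big_mkcond /=.
  by apply: eq_bigr => p _; rewrite inE; case: ltnP => //=; case: eqP.
(* An index outside [D] is the least of its fibre, so [f] is injective there. *)
pose D := [set p.2 | p in Q].
apply: leq_trans (leq_imset_card snd Q); rewrite -/D.
have : (#|~: D| <= c)%N.
  rewrite -[X in (_ <= X)%N]card_ord -(card_in_imset (f := f)) ?max_card //.
  move=> i j hi hj E; case: (ltngtP i j) => [lt|lt|/ord_inj//].
    move: hj; rewrite inE => /imsetP[]; exists (i, j) => //.
    by rewrite inE /= lt E eqxx.
  move: hi; rewrite inE => /imsetP[]; exists (j, i) => //.
  by rewrite inE /= lt E eqxx.
by have := cardsC D; rewrite card_ord; lia.
Qed.

Lemma sum_ltn_pairs m : (\sum_(p : 'I_m * 'I_m | (p.1 < p.2)%N) 1 = 'C(m, 2))%N.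
Proof.
rewrite -bin2_sum big_mkord (reindex_inj (inv_inj (@swap_pairK _ _))) /=.
rewrite -(pair_big_dep xpredT (fun j i : 'I_m => (i < j)%N) (fun _ _ => 1%N)) /=.
apply: eq_bigr => j _.
have := big_ord_widen m (fun=> 1%N) (ltnW (ltn_ord j)) => /= <-.
by rewrite sum1_card card_ord.
Qed.

(** The pairs embed into the product of [T] and its complement, and [4 * a * b <= (a + b) ^ 2]. *)
Lemma sum_distinct_pairs m (t : 'I_m -> bool) :
  (4 * \sum_(p : 'I_m * 'I_m | (p.1 < p.2)%N) (t p.1 != t p.2) <= m ^ 2)%N.
Proof.
pose T := [set i | t i].
have Em : (#|T| + #|~: T| = m)%N by rewrite cardsC card_ord.
have := (nat_AGM2 #|T| #|~: T|).1; rewrite Em; apply: leq_trans.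
rewrite leq_mul2l /= -cardsX.
pose Q := [set p : 'I_m * 'I_m | (p.1 < p.2)%N && (t p.1 != t p.2)].
have -> : (\sum_(p : 'I_m * 'I_m | (p.1 < p.2)%N) (t p.1 != t p.2) = #|Q|)%N.
  rewrite -sum1_card big_mkcond [RHS]big_mkcond /=.
  by apply: eq_bigr => p _; rewrite inE; case: ltnP => //=; case: eqP.
pose g (p : 'I_m * 'I_m) := if t p.1 then p else (p.2, p.1).
rewrite -(card_in_imset (f := g)).
  apply: subset_leq_card; apply/subsetP => _ /imsetP[[i j] hp ->].
  move: hp; rewrite !inE /g /= => /andP[_].
  by case E: (t i); case E': (t j) => //=; rewrite E.
move=> [i j] [i' j']; rewrite !inE /g /= => /andP[h1 h2] /andP[h3 h4].
case: ifP; case: ifP => _ _ [E1 E2]; subst => //.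
  by have := ltn_trans h1 h3; rewrite ltnn.
by have := ltn_trans h1 h3; rewrite ltnn.
Qed.

(** * The double count over paths and pairs *)

Section Bipartite.
Variables (m n k : nat) (A : 'I_m -> seq edge) (B : 'I_n -> seq edge).
Hypotheses (A_link : forall i, sorted link (A i)) (B_link : forall b, sorted link (B b)).
Hypotheses (A_turns : forall i, (nturns (A i) <= k)%N).
Hypotheses (B_turns : forall b, (nturns (B b) <= k)%N).
Hypothesis A_nonempty : forall i, A i != [::].
Hypothesis A_disj : forall i i' (z : edge), z \in A i -> z \in A i' -> i = i'.
Hypothesis B_disj : forall b b' (z : edge), z \in B b -> z \in B b' -> b = b'.
Hypothesis AB : forall i b, exists z : edge, (z \in A i) && (z \in B b).

Let contact i b : edge := xchoose (AB i b).

Lemma contact_A i b : contact i b \in A i.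
Proof. by case/andP: (xchooseP (AB i b)). Qed.

Lemma contact_B i b : contact i b \in B b.
Proof. by case/andP: (xchooseP (AB i b)). Qed.

Let class b i : 'I_(uphalf k.+1) := Ordinal (group_lt _ (contact i b) _ (B_turns b)).
Let initial_dir i : bool := (head ((true, 0), 0) (A i)).1.1.

Lemma class_near b i j : class b i = class b j ->
  near (B b) (contact i b) (contact j b).
Proof. by case=> h; apply: group_near h => //; apply: contact_B. Qed.

Lemma A_disjoint i j : i != j -> forall z : edge, z \in A i -> z \in A j -> False.
Proof. by move=> /eqP hij z h1 h2; apply: hij; apply: A_disj h1 h2. Qed.

(** There are at most [k] events for equal initial directions and [k + 1] otherwise, whence the 1 in
    the last factor. *)
Lemma card_same_class i j : (0 < k)%N -> i != j ->
  (#|[set b | class b i == class b j]| <= 2 * k.+1./2 * uphalf k.+1 + k +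
     (initial_dir i != initial_dir j) * (1 + (uphalf k.+1 - k.+1./2)))%N.
Proof.
move=> k0 hij; set S := [set b | _].
have hS b : b \in S -> near (B b) (contact i b) (contact j b).
  by rewrite inE => /eqP/class_near.
have hA := A_disjoint _ _ hij.
apply: leq_trans (card_near _ _ _ _ _ _ S (A_link i) (A_link j) B_link hA B_disj
  (contact_A i) (contact_B i) (contact_A j) (contact_B j) hS) _.
rewrite /initial_dir.
move: (A_nonempty i) (A_nonempty j) (A_link i) (A_link j) (A_turns i) (A_turns j) hA.
case: (A i) (A j) => [//|e u] [//|e' u'] _ _ hp hp' hk hk' hA.
have := crossings_bound _ _ _ _ _ hp hp' hk hk'.
have := size_events (e :: u) (e' :: u') hp'.
have := size_lines _ _ hp; rewrite /=.
have [E|E] := eqVneq (e.1.1) (e'.1.1); last by move: hk => /=; clear; lia.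
have := size_events_lt _ _ _ _ _ k0 hp hp' hA E hk hk'; rewrite /=; clear; lia.
Qed.

(** Two segments on a common line form an event, so the bound [k] on events fails for [k = 0]; in
    exchange no B-path bends. *)
Lemma card_same_class0 i j : k = 0%N -> i != j ->
  (#|[set b | class b i == class b j]| <= 1)%N.
Proof.
move=> k0 hij; set S := [set b | _].
have hS b : b \in S -> near (B b) (contact i b) (contact j b).
  by rewrite inE => /eqP/class_near.
have hA := A_disjoint _ _ hij.
have hB b : nturns (B b) = 0%N by apply/eqP; rewrite -leqn0 -k0.
apply: leq_trans (card_near_straight _ _ _ _ _ _ S (A_link i) (A_link j) B_link hA
  B_disj (contact_A i) (contact_B i) (contact_A j) (contact_B j) hS hB) _.
move: (A_nonempty i) (A_link i) (A_link j) (A_turns i).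
case: (A i) => [//|e u] _ hp hp' hk.
have := size_events (e :: u) (A j) hp'.
have := size_lines _ _ hp; rewrite k0 in hk; move: hk; rewrite /=; clear; lia.
Qed.

Lemma bipartite_bound :
  (4 * (n * (m - uphalf k.+1)) <=
   4 * ('C(m, 2) * (2 * k.+1./2 * uphalf k.+1 + k)) +
   m ^ 2 * (1 + (uphalf k.+1 - k.+1./2)))%N.
Proof.
have : (n * (m - uphalf k.+1) <=
    \sum_(p : 'I_m * 'I_m | (p.1 < p.2)%N) #|[set b | class b p.1 == class b p.2]|)%N.
  have -> : (n * (m - uphalf k.+1) = \sum_(b < n) (m - uphalf k.+1))%N.
    by rewrite sum_nat_const card_ord.
  apply: (@leq_trans (\sum_(b < n) \sum_(p : 'I_m * 'I_m | (p.1 < p.2)%N)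
      (class b p.1 == class b p.2))%N).
    by apply: leq_sum => b _; apply: (card_same_fiber _ _ (class b)).
  rewrite exchange_big /=; apply: leq_sum => p _.
  rewrite -sum1_card [X in (_ <= X)%N]big_mkcond /= leq_sum // => b _.
  by rewrite inE; case: eqP.
move=> h; apply: leq_trans (leq_mul (leqnn 4) h) _.
have [k0|k0] := posnP k.
  have : (\sum_(p : 'I_m * 'I_m | (p.1 < p.2)%N) #|[set b | class b p.1 == class b p.2]|
      <= 'C(m, 2))%N.
    rewrite -sum_ltn_pairs; apply: leq_sum => p lt; apply: card_same_class0 => //.
    by apply: contraTneq lt => ->; rewrite ltnn.
  move=> h1; apply: leq_trans (leq_mul (leqnn 4) h1) _.
  (* The right-hand side is [2 * m ^ 2], against [4 * 'C(m, 2) = 2 * m * m.-1]. *)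
  rewrite k0 /=; have := mul_bin_diag m 1; rewrite bin1.
  by have : (m * m.-1 <= m ^ 2)%N by [rewrite leq_mul2l leq_pred orbT]; clear; lia.
have : (\sum_(p : 'I_m * 'I_m | (p.1 < p.2)%N) #|[set b | class b p.1 == class b p.2]|
    <= 'C(m, 2) * (2 * k.+1./2 * uphalf k.+1 + k) +
      (\sum_(p : 'I_m * 'I_m | (p.1 < p.2)%N) (initial_dir p.1 != initial_dir p.2)) *
      (1 + (uphalf k.+1 - k.+1./2)))%N.
  rewrite -sum_ltn_pairs !big_distrl -big_split /=; apply: leq_sum => p lt.
  rewrite mul1n; apply: card_same_class => //.
  by apply: contraTneq lt => ->; rewrite ltnn.
move=> h1; apply: leq_trans (leq_mul (leqnn 4) h1) _.
rewrite mulnDr mulnA [X in (_ + X <= _)%N]mulnA leq_add2l leq_mul2r.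
by rewrite sum_distinct_pairs orbT.
Qed.

End Bipartite.

(** * From lists of grid points to sequences of edges *)

Definition edge_of (pq : gpoint * gpoint) : edge :=
  let: (p, q) := pq in
  if p.2 == q.2 then ((true, p.2), if p.1 <= q.1 then p.1 else q.1)
  else ((false, p.1), if p.2 <= q.2 then p.2 else q.2).

Lemma grid_adjE p q : grid_adj p q =
  (p.1 == q.1) && (`|p.2 - q.2| == 1) || (p.2 == q.2) && (`|p.1 - q.1| == 1).
Proof. by []. Qed.

Lemma edge_of_adj p q : grid_adj p q ->
  (p, q) = (source (edge_of (p, q)), target (edge_of (p, q))) \/
  (q, p) = (source (edge_of (p, q)), target (edge_of (p, q))).
Proof.
rewrite /source /target; case: p q => [x y] [x' y'] /=.
rewrite grid_adjE /= => /orP[]/andP[/eqP-> h].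
  have [E|_] := eqVneq y y'; first by move: h; rewrite E; lia.
  by case: ifP => h' /=; [left|right]; congr ((_, _), (_, _)); lia.
by rewrite eqxx; case: ifP => h' /=; [left|right]; congr ((_, _), (_, _)); lia.
Qed.

Lemma edge_ofC p q : grid_adj p q -> edge_of (q, p) = edge_of (p, q).
Proof.
case: p q => [x y] [x' y']; rewrite grid_adjE /= [y' == y]eq_sym.
by case: (y =P y') => E /= h; congr ((_, _), _); do 2?case: ifP; lia.
Qed.

Lemma edge_of_source_target e : edge_of (source e, target e) = e.
Proof.
case: e => [[d y] x]; have h : x <= x + 1 by lia.
have n : (x == x + 1) = false by lia.
by case: d; rewrite /source /target /= ?eqxx ?n h.
Qed.

Lemma edge_of_turn p q r : grid_adj p q -> grid_adj q r ->
  turn p q r = ((edge_of (p, q)).1.1 != (edge_of (q, r)).1.1).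
Proof.
case: p q r => [x y] [x' y'] [x'' y''].
rewrite /turn !grid_adjE /vert_edge /horiz_edge /=.
by case: (y == y') / eqP => h1; case: (y' == y'') / eqP => h2 /=; lia.
Qed.

Lemma ascending_link p q r : grid_adj p q -> grid_adj q r ->
  ascending_step p q -> ascending_step q r -> link (edge_of (p, q)) (edge_of (q, r)).
Proof.
move=> a1 a2 h1 h2; rewrite /link.
have H p0 q0 : grid_adj p0 q0 -> ascending_step p0 q0 ->
    (p0, q0) = (source (edge_of (p0, q0)), target (edge_of (p0, q0))).
  move=> a h; case: (edge_of_adj _ _ a) => // E; exfalso; move: h E.
  move: (edge_of _) => e h [E1 E2]; move: h; rewrite E1 E2 /ascending_step.
  by case: e {E1 E2} => [[[] y] x]; rewrite /source /target /=; lia.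
by have [_ <-] := H _ _ a1 h1; have [<- _] := H _ _ a2 h2.
Qed.

Lemma steps_rel (r : rel gpoint) s pq : sorted r s -> pq \in steps s -> r pq.1 pq.2.
Proof.
elim: s => [//|p [//|q s] IH] /= /andP[h1 h2].
by rewrite inE => /predU1P[-> //|]; apply: IH.
Qed.

Lemma sorted_link_steps s : sorted grid_adj s -> sorted ascending_step s ->
  sorted link [seq edge_of pq | pq <- steps s].
Proof.
elim: s => [//|p [//|q [//|r s]] IH] /andP[a1 a] /andP[h1 h].
have /andP[a2 _] := a; have /andP[h2 _] := h.
by apply/andP; split; [apply: ascending_link|apply: IH].
Qed.

Lemma nturns_steps s : sorted grid_adj s ->
  nturns [seq edge_of pq | pq <- steps s] = bends s.
Proof.
elim: s => [//|p [//|q [//|r s]] IH] /andP[a1 a].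
have /andP[a2 _] := a; have := IH a.
rewrite [steps (p :: _)]/= [map _ (_ :: _)]/=.
by move=> E; rewrite [RHS]/= -/(bends (q :: r :: s)) -E edge_of_turn.
Qed.

Lemma grid_adjC p q : grid_adj p q = grid_adj q p.
Proof.
rewrite !grid_adjE eq_sym distrC [p.2 == _]eq_sym.
by rewrite [X in _ || _ && (X == _)]distrC.
Qed.

Lemma sorted_link_steps_rev s : sorted grid_adj s ->
  sorted ascending_step (rev s) -> sorted link (rev [seq edge_of pq | pq <- steps s]).
Proof.
rewrite !rev_sorted; elim: s => [//|p [//|q [//|r s]] IH] /andP[a1 a] /andP[h1 h].
have /andP[a2 _] := a; have /andP[h2 _] := h.
apply/andP; split; last exact: IH.
by rewrite -edge_ofC // -[edge_of (p, q)]edge_ofC //;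
  apply: ascending_link; rewrite // grid_adjC.
Qed.

(** For a monotonic path this lists the edges in ascending order, whichever end the path is read
    from. *)
Definition staircase (s : seq gpoint) : seq edge :=
  let w := [seq edge_of pq | pq <- steps s] in
  if sorted ascending_step s then w else rev w.

Lemma mem_staircase s e : grid_path s ->
  (e \in staircase s) = uses_edge s (source e) (target e).
Proof.
move=> /and3P[_ hs _].
have -> : (e \in staircase s) = (e \in [seq edge_of pq | pq <- steps s]).
  by rewrite /staircase; case: ifP => _; rewrite ?mem_rev.
apply/mapP/orP => [[[p q] h ->]|[] h].
- by have := steps_rel _ _ _ hs h => /edge_of_adj[] [<- <-]; [left|right].
- by exists (source e, target e); rewrite ?edge_of_source_target.
exists (target e, source e) => //; rewrite -edge_ofC ?edge_of_source_target //.
exact: steps_rel hs h.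
Qed.

Lemma share_edgeP s t : grid_path s -> grid_path t ->
  share_edge s t <-> exists e : edge, (e \in staircase s) && (e \in staircase t).
Proof.
move=> hs ht; split=> [[p [q [h1 h2]]]|[e /andP[]]]; last first.
  by rewrite !mem_staircase // => h1 h2; exists (source e), (target e).
have a : grid_adj p q.
  case/and3P: hs => _ hs _; case/orP: h1 => /(steps_rel _ _ _ hs) //=.
  by rewrite grid_adjC.
exists (edge_of (p, q)); rewrite !mem_staircase //.
have [|] := edge_of_adj _ _ a => -[<- <-]; first by rewrite h1 h2.
by move: h1 h2; rewrite /uses_edge orbC => ->; rewrite orbC => ->.
Qed.

Lemma staircase_neq0 s : grid_path s -> staircase s != [::].
Proof.
case/and3P; case: s => [//|p [//|q s]] _ _ _; rewrite /staircase.
by case: ifP => _ //; rewrite -size_eq0 size_rev.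
Qed.

Lemma sorted_staircase s : grid_path s -> monotonic s -> sorted link (staircase s).
Proof.
case/and3P=> _ hs _; rewrite /monotonic /staircase.
case: ifP => [h _|_ /= h]; first exact: sorted_link_steps.
exact: sorted_link_steps_rev.
Qed.

Lemma nturns_staircase s : grid_path s -> nturns (staircase s) = bends s.
Proof.
case/and3P=> _ hs _; rewrite /staircase; case: ifP => _; rewrite ?nturns_rev;
exact: nturns_steps.
Qed.

Theorem lemma2p6 (m n k : nat) (hm : (3 <= m)%N) (hmn : (m <= n)%N)
    (hrep : exists P : ('I_m + 'I_n)%type -> seq gpoint,
        Bm_EPG_representation k (@complete_bipartite m n) P) :
  (n%:R * (m%:R - (uphalf k.+1)%:R) : rat) <=
    ('C(m, 2))%:R * (2%:R * (k.+1)./2%:R * (uphalf k.+1)%:R + k%:R)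
    + 1 / 4%:R * m%:R ^+ 2 * (1 + (uphalf k.+1)%:R - (k.+1)./2%:R).
Proof.
have [P [[gP adjP] kP]] := hrep.
have lP v : sorted link (staircase (P v)) by apply: sorted_staircase => //; case: (kP v).
have tP v : (nturns (staircase (P v)) <= k)%N.
  by rewrite nturns_staircase //; case: (kP v).
have nP v : staircase (P v) != [::] by apply: staircase_neq0.
have dP v v' (z : edge) : ~~ complete_bipartite v v' ->
    z \in staircase (P v) -> z \in staircase (P v') -> v = v'.
  move=> na h1 h2; apply/eqP; apply: contraNT na => hv; apply/(adjP _ _ hv).
  by apply/share_edgeP => //; exists z; rewrite h1.
have h : (4 * (n * (m - uphalf k.+1)) <=
   4 * ('C(m, 2) * (2 * k.+1./2 * uphalf k.+1 + k)) +
   m ^ 2 * (1 + (uphalf k.+1 - k.+1./2)))%N.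
  apply: (bipartite_bound m n k (fun i => staircase (P (inl i)))
           (fun j => staircase (P (inr j)))) => //.
  - by move=> i i' z h1 h2; have [] := dP (inl i) (inl i') z isT h1 h2.
  - by move=> j j' z h1 h2; have [] := dP (inr j) (inr j') z isT h1 h2.
  - by move=> i j; apply/share_edgeP => //; apply/adjP.
have hc : (k.+1./2 <= uphalf k.+1)%N by rewrite uphalf_half leq_addl.
have -> : 1 + (uphalf k.+1)%:R - k.+1./2%:R = (1 + (uphalf k.+1 - k.+1./2))%:R :> rat.
  by rewrite natrD natrB // addrA.
(* If [m] is below [uphalf k.+1], truncation gives 0, which exceeds the negative rational
   difference. *)
have hm' : (m%:R - (uphalf k.+1)%:R : rat) <= (m - uphalf k.+1)%:R.
  by rewrite lerBlDr -natrD ler_nat addnC -leq_subLR.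
have := ler_wpM2l (ler0n rat n) hm'; rewrite -natrM.
move: h; rewrite -(ler_nat rat) !natrD !natrM !natrD.
set x := (_ * (m - _)%:R); set y := _%:R * (_ - _); set z := 'C(m, 2)%:R.
set u := (uphalf _ - _)%:R; set v := uphalf _; set f := _./2.
lra.
Qed.
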